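(* Let $p\ge 1$ be an integer, $I\ge 2$, $\mathcal I=\{1,\dots,I\}$, $N\ge 1$, and let $\bar a_k,\bar b_{ik}\in\mathbb R$ and $\bar q_{ik},\bar q_{iN},\bar r_{ik}>0$ for $i\in\mathcal I$, $k\in\{0,\dots,N-1\}$. Consider the deterministic scalar system $$\bar x_{k+1}=\bar a_k\bar x_k+\sum_{i\in\mathcal I}\bar b_{ik}\bar u_{ik},\qquad k\in\{0,\dots,N-1\},\quad \bar x_0\in\mathbb R \text{ given},$$ in which each agent $i\in\mathcal I$ chooses $(\bar u_{ik})_{k=0}^{N-1}$ in order to minimize $$L_i(\bar x_0,\bar u)=\bar q_{iN}\bar x_N^{2p}+\sum_{k=0}^{N-1}\left(\bar q_{ik}\bar x_k^{2p}+\bar r_{ik}\bar u_{ik}^{2p}\right).$$ Define $\bar\alpha_{ik}$ by backward recursion: $\bar\alpha_{iN}=\bar q_{iN}$ and, for $k=N-1,\dots,0$, $$\bar\alpha_{ik}=\bar q_{ik}+\bar r_{ik}\left((\bar E_k^{-1}\bar c_k)_i\,\bar a_k\right)^{2p}+\bar\alpha_{i,k+1}\left(\bar a_k-\sum_{j\in\mathcal I}(\bar E_k^{-1}\bar c_k)_j\,\bar a_k\bar b_{jk}\right)^{2p},$$ where $\bar c_k=(\bar c_{1k},\dots,\bar c_{Ik})^\top$ with $$\bar c_{ik}=\frac{\left(\frac{\bar\alpha_{i,k+1}\bar b_{ik}}{\bar r_{ik}}\right)^{1/(2p-1)}}{1+\left(\frac{\bar\alpha_{i,k+1}\bar b_{ik}}{\bar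 r_{ik}}\right)^{1/(2p-1)}\bar b_{ik}},$$ and $\bar E_k$ is the $I\times I$ matrix with entries $\bar e_{ii,k}=1$ and $\bar e_{ij,k}=\bar c_{ik}\bar b_{jk}$ for $j\ne i$. Then the (state-feedback Nash) equilibrium strategy of the game is $$\bar u_{ik}^*=-(\bar E_k^{-1}\bar c_k)_i\,(\bar a_k\bar x_k),\qquad i\in\mathcal I,\ k\in\{0,\dots,N-1\}.$$
   Context: $(2p-1)$-th roots are real (odd) roots. The control set of each agent at each step is $\mathbb R$; a strategy of agent $i$ is a sequence $(\bar u_{ik})_{k=0}^{N-1}$ of Lebesgue measurable state-feedback maps, $\bar u_{ik}=\bar u_{ik}(\bar x_k)\in\mathbb R$. A profile $(\bar u_i^* )_{i\in\mathcal I}$ of such strategies is a state-feedback Nash equilibrium if, for every $i\in\mathcal I$, when all agents $j\neq i$ use the feedback strategies $\bar u_j^*$, the strategy $\bar u_i^*$ minimizes $L_i$ over all strategies of agent $i$. *)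

(* Defs.v *)
From mathcomp Require Import all_boot all_order all_algebra.
From mathcomp Require Import all_classical all_reals all_analysis.
From mathcomp Require Import measurable_realfun.

Set Implicit Arguments.
Unset Strict Implicit.
Unset Printing Implicit Defensive.

Import Order.TTheory GRing.Theory Num.Theory.
Local Open Scope ring_scope.

Definition odd_root (R : realType) (m : nat) (y : R) : R :=
  Num.sg y * (`|y| `^ (m%:R^-1)).

Lemma odd_rootK (R : realType) (m : nat) (y : R) :
  odd m -> odd_root m y ^+ m = y.
Proof.
move=> om; have m0 : (0 < m)%N by case: m om.
rewrite /odd_root exprMn.
rewrite -[X in _ * X](powR_mulrn m (powR_ge0 _ _)) -powRrM.
rewrite mulVf ?pnatr_eq0 -?lt0n// powRr1// [RHS]numEsg; congr (_ * _).
case: (sgrP y) => _; rewrite ?expr1n//; first by rewrite expr0n -[m]prednK.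
by rewrite -signr_odd om expr1.
Qed.

(* Lebesgue measurable, i.e. preimages of Borel sets lie in the completion of
   the Borel sigma-algebra; [measurable_fun] between two copies of [R] would
   only describe Borel maps. *)
Definition lebesgue_measurable_fun (R : realType) (f : R -> R) : Prop :=
  @measurable_fun _ _
    (g_sigma_algebraType (completed_algebra_gen (@lebesgue_measure R)))
    (measurableTypeR R) setT f.

(* Data indexed by time are functions of [k : nat]; only [k < N] (and [k <= N]
   for [q], whose value at [N] is the terminal weight) is relevant. *)
Section Game.
Variables (R : realType) (n p N : nat).
Variables (a : nat -> R) (b q r : 'I_n -> nat -> R).

Definition strategy : Type := nat -> R -> R.
Definition profile : Type := 'I_n -> strategy.

Definition admissible (v : strategy) : Prop :=
  forall k, (k < N)%N -> lebesgue_measurable_fun (v k).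

Fixpoint state (u : profile) (x0 : R) (k : nat) : R :=
  if k is k'.+1 then
    let x := state u x0 k' in a k' * x + \sum_(i < n) b i k' * u i k' x
  else x0.

Definition cost (i : 'I_n) (x0 : R) (u : profile) : R :=
  q i N * state u x0 N ^+ (2 * p) +
  \sum_(k < N) (q i k * state u x0 k ^+ (2 * p) +
                r i k * u i k (state u x0 k) ^+ (2 * p)).

Definition deviation (u : profile) (i : 'I_n) (v : strategy) : profile :=
  fun j => if j == i then v else u j.

Definition nash_equilibrium (x0 : R) (u : profile) : Prop :=
  (forall i, admissible (u i)) /\
  (forall i (v : strategy), admissible v ->
     cost i x0 u <= cost i x0 (deviation u i v)).

(* One stage [k] of the backward recursion, [al] being the value of alpha at
   time [k.+1]. *)
Section Stage.
Variables (al : 'I_n -> R) (k : nat).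

Definition stage_root (i : 'I_n) : R :=
  odd_root (2 * p - 1) (al i * b i k / r i k).

Definition stage_c : 'cV[R]_n :=
  \col_i (stage_root i / (1 + stage_root i * b i k)).

Definition stage_E : 'M[R]_n :=
  \matrix_(i, j) (if j == i then 1 else stage_c i 0 * b j k).

Definition stage_gain : 'cV[R]_n := invmx stage_E *m stage_c.

Definition stage_alpha (i : 'I_n) : R :=
  q i k + r i k * (stage_gain i 0 * a k) ^+ (2 * p)
  + al i * (a k - \sum_(j < n) stage_gain j 0 * a k * b j k) ^+ (2 * p).

End Stage.

(* [alpha_rev m] is alpha at time [N - m]. *)
Fixpoint alpha_rev (m : nat) : 'I_n -> R :=
  if m is m'.+1 then stage_alpha (alpha_rev m') (N - m) else fun i => q i N.

Definition alpha (i : 'I_n) (k : nat) : R := alpha_rev (N - k) i.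

Definition root_bar (i : 'I_n) (k : nat) : R := stage_root (alpha^~ k.+1) k i.
Definition c_bar (k : nat) : 'cV[R]_n := stage_c (alpha^~ k.+1) k.
Definition E_bar (k : nat) : 'M[R]_n := stage_E (alpha^~ k.+1) k.
Definition gain (k : nat) : 'cV[R]_n := invmx (E_bar k) *m c_bar k.

Lemma alpha_N i : alpha i N = q i N.
Proof. by rewrite /alpha subnn. Qed.

Lemma alpha_rec i k : (k < N)%N ->
  alpha i k = q i k + r i k * (gain k i 0 * a k) ^+ (2 * p)
    + alpha i k.+1 * (a k - \sum_(j < n) gain k j 0 * a k * b j k) ^+ (2 * p).
Proof.
move=> kN; rewrite {1}/alpha.
by rewrite -(subnSK kN) /= subnSK// subKn// ltnW.
Qed.

Definition equilibrium_profile : profile :=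
  fun i k x => - (gain k i 0) * (a k * x).

End Game.

(* Main.v *)
Require Import Defs.
From mathcomp Require Import all_boot all_order all_algebra.
From mathcomp Require Import all_classical all_reals all_analysis.
From mathcomp Require Import measurable_realfun zify ring lra.

Import Order.TTheory GRing.Theory Num.Theory.
Local Open Scope ring_scope.

(** The proof is dynamic programming: [V_i k x = alpha_i k * x ^+ (2 * p)] is
    the value function of agent [i] when the others play the equilibrium
    feedback.

    Solvability.  Write [g_i] for the odd root in the definition of [c_i].
    Since [alpha_i] ([alpha_gt0]) and [r_i] are positive, [g_i] has the sign of
    [b_i], so [g_i * b_i >= 0]; hence [1 + g_i * b_i] is nonzero, and so is
    [1 + G] with [G = \sum_j g_j * b_j].  Entry [i] of [E *m w] is
    [w_i + g_i * \sum_j b_j * w_j] divided by [1 + g_i * b_i]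
    ([stage_E_mulmx]), that is, [E] is a rank-one perturbation of the identity
    up to row scaling.  So [E] is invertible ([stage_E_unitmx]) and
    [E^-1 c] is explicit: its entries are [g_i / (1 + G)] ([stage_gainE]).

    Optimality.  With this gain the next state is [y = a * x / (1 + G)], and
    agent [i] plays [- g_i * y].  This is exactly the first-order condition
    [r_i * u ^+ (2 * p - 1) + alpha_i * b_i * y ^+ (2 * p - 1) = 0] of the
    one-stage problem; since even powers are convex, a critical point is a
    global minimum ([even_power_tangent], [best_response]).  The recursion for
    [alpha] says that the minimum equals [V_i k x], so [V_i] satisfies the
    Bellman equation.  Telescoping [V_i] along a trajectory
    ([cost_telescope]) then gives [V_i 0 x0] as the equilibrium cost and as a
    lower bound for the cost of every deviation. *)

(** * Convexity of even powers *)

(** Weighted arithmetic-geometric mean inequality; the induction step from [m]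
    to [m.+1] adds [(m + 1) * t ^+ m * (y - t) ^+ 2] to [y] times the previous
    difference of the two sides. *)
Lemma nneg_power_tangent (R : realDomainType) (m : nat) (y t : R) :
  0 <= y -> 0 <= t -> m.+1%:R * t ^+ m * y <= y ^+ m.+1 + m%:R * t ^+ m.+1.
Proof.
move=> y0 t0; elim: m => [|m IH]; first by rewrite expr0 mul0r; lra.
rewrite -subr_ge0.
have -> : y ^+ m.+2 + m.+1%:R * t ^+ m.+2 - m.+2%:R * t ^+ m.+1 * y =
    y * (y ^+ m.+1 + m%:R * t ^+ m.+1 - m.+1%:R * t ^+ m * y)
    + m.+1%:R * t ^+ m * (y - t) ^+ 2.
  by rewrite !exprS -!natr1; ring.
apply: addr_ge0; first by rewrite mulr_ge0 ?subr_ge0.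
by rewrite mulr_ge0 ?sqr_ge0// mulr_ge0 ?exprn_ge0 ?ler0n.
Qed.

(** Taking absolute values leaves the even powers unchanged and can only
    increase the mixed term, which reduces the claim to nonnegative reals. *)
Lemma even_power_tangent (R : realDomainType) (p : nat) (y t : R) : (0 < p)%N ->
  t ^+ (2 * p) + (2 * p)%:R * t ^+ (2 * p - 1) * (y - t) <= y ^+ (2 * p).
Proof.
move=> p0.
have [m mE] : exists m, (2 * p = m.+1)%N by exists (2 * p).-1; lia.
have abs_even (z : R) : `|z| ^+ m.+1 = z ^+ m.+1.
  by rewrite -normrX ger0_norm// -mE exprn_even_ge0// oddM.
have := @nneg_power_tangent R m `|y| `|t| (normr_ge0 _) (normr_ge0 _).
rewrite mE subn1 /= !abs_even => H.
have : m.+1%:R * t ^+ m * y <= m.+1%:R * `|t| ^+ m * `|y|.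
  by rewrite -!mulrA -normrX -normrM ler_wpM2l ?ler0n ?ler_norm.
move: H; rewrite [t ^+ m.+1]exprS -natr1; lra.
Qed.

(** * The one-stage problem of a single agent *)

Lemma odd_2pB1 p : (0 < p)%N -> odd (2 * p - 1).
Proof. by move=> p0; rewrite oddB ?oddM//; lia. Qed.

Lemma odd_root_mulr_ge0 (R : realType) (m : nat) (y z : R) :
  0 <= y * z -> 0 <= odd_root m y * z.
Proof.
move=> yz; rewrite /odd_root mulrAC mulr_ge0 ?powR_ge0//.
by case: (sgrP y) yz => [_|y0|y0]; rewrite ?mul0r// ?mul1r ?mulN1r;
  [rewrite pmulr_rge0|rewrite nmulr_rge0// oppr_ge0].
Qed.

(** With [y] the next state, the control [- (g * y)] is a critical point of the
    cost as a function of the control [v], because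
    [r * g ^+ (2 * p - 1) = al * b]; convexity turns this into a global
    minimum. *)
Lemma best_response (R : realFieldType) (p : nat) (al b r g y v : R) :
  (0 < p)%N -> 0 < al -> 0 < r -> g ^+ (2 * p - 1) = al * b / r ->
  r * (- (g * y)) ^+ (2 * p) + al * y ^+ (2 * p) <=
  r * v ^+ (2 * p) + al * (y + b * (v + g * y)) ^+ (2 * p).
Proof.
move=> p0 al0 r0 gX.
have gE : r * (- (g * y)) ^+ (2 * p - 1) = - (al * b * y ^+ (2 * p - 1)).
  rewrite exprNn -signr_odd odd_2pB1// expr1 exprMn gX.
  by field; rewrite gt_eqF.
have /(ler_wpM2l (ltW r0)) := even_power_tangent R p v (- (g * y)) p0.
have /(ler_wpM2l (ltW al0)) :=
  even_power_tangent R p (y + b * (v + g * y)) y p0.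
move=> Hy Hv; apply: le_trans (lerD Hv Hy).
have -> : r * ((- (g * y)) ^+ (2 * p) +
    (2 * p)%:R * (- (g * y)) ^+ (2 * p - 1) * (v - - (g * y))) =
    r * (- (g * y)) ^+ (2 * p) +
    (2 * p)%:R * (r * (- (g * y)) ^+ (2 * p - 1)) * (v + g * y) by ring.
by rewrite gE le_eqVlt; apply/orP; left; apply/eqP; ring.
Qed.

(** * Solving the linear system of one stage *)

Section StageGain.
Variables (R : realType) (n p : nat) (b r : 'I_n -> nat -> R).
Variables (al : 'I_n -> R) (k : nat).
Hypothesis al_gt0 : forall i, 0 < al i.
Hypothesis r_gt0 : forall i, 0 < r i k.

Let g i := stage_root p b r al k i.
Let G := \sum_j g j * b j k.

Lemma stage_root_mul_ge0 i : 0 <= g i * b i k.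
Proof.
apply: odd_root_mulr_ge0.
rewrite (_ : _ * _ = b i k ^+ 2 * (al i / r i k)); last by ring.
by rewrite mulr_ge0 ?sqr_ge0// divr_ge0// ltW.
Qed.

Lemma stage_root_denom_neq0 i : 1 + g i * b i k != 0.
Proof. by rewrite gt_eqF// ltr_pwDl// stage_root_mul_ge0. Qed.

Lemma stage_root_sum_neq0 : 1 + G != 0.
Proof.
rewrite gt_eqF// ltr_pwDl// sumr_ge0// => i _; exact: stage_root_mul_ge0.
Qed.

Lemma stage_E_mulmx (w : 'cV[R]_n) i :
  (stage_E p b r al k *m w) i 0 =
  (w i 0 + g i * \sum_j b j k * w j 0) / (1 + g i * b i k).
Proof.
have gi := stage_root_denom_neq0 i.
rewrite mxE (bigD1 i)//= mxE eqxx mul1r.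
rewrite [X in _ = (_ + g i * X) / _](bigD1 i)//=.
under eq_bigr => j /negbTE ji.
  rewrite 2!mxE ji -mulrA; over.
rewrite -mulr_sumr -/(g i).
by field.
Qed.

(** If [E *m w = 0] then [w_i = - g_i * S] with [S = \sum_j b_j * w_j], so
    [S = - G * S], which forces [S = 0] and then [w = 0]. *)
Lemma stage_E_unitmx : stage_E p b r al k \in unitmx.
Proof.
rewrite -unitmx_tr -row_free_unit; apply: inj_row_free => v vE.
have Ew : stage_E p b r al k *m v^T = 0.
  by apply: trmx_inj; rewrite trmx_mul trmxK vE trmx0.
set S := \sum_j b j k * v^T j 0.
have wE i : v^T i 0 = - g i * S.
  have /matrixP/(_ i 0) := Ew; rewrite stage_E_mulmx [RHS]mxE => /eqP.
  rewrite mulf_eq0 invr_eq0 (negbTE (stage_root_denom_neq0 i)) orbF.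
  by rewrite addr_eq0 mulNr => /eqP.
have : (1 + G) * S = 0.
  rewrite mulrDl mul1r mulr_suml {1}/S -big_split/= big1// => i _.
  by rewrite wE; ring.
move/eqP; rewrite mulf_eq0 (negbTE stage_root_sum_neq0)/= => /eqP S0.
apply/rowP => i; have := wE i; rewrite S0 mulr0 !mxE => <-; congr (v _ _).
Qed.

Lemma stage_gainE i : stage_gain p b r al k i 0 = g i / (1 + G).
Proof.
have G0 := stage_root_sum_neq0.
suff -> : stage_gain p b r al k = \col_j (g j / (1 + G)) by rewrite mxE.
rewrite /stage_gain -[RHS](mulKmx stage_E_unitmx); congr (_ *m _).
apply/matrixP => j l; rewrite [l]ord1 stage_E_mulmx 2!mxE -/(g j).
have -> : \sum_j0 b j0 k * (\col_j1 (g j1 / (1 + G))) j0 0 = G / (1 + G).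
  by rewrite mulr_suml; apply: eq_bigr => s _; rewrite mxE; ring.
by congr (_ / _); field.
Qed.

(** The closed-loop factor is [1 - G / (1 + G)]. *)
Lemma stage_closed_loop (z : R) :
  z + \sum_j b j k * (- stage_gain p b r al k j 0 * z) = z / (1 + G).
Proof.
have G0 := stage_root_sum_neq0.
under eq_bigr => j _.
  rewrite stage_gainE.
  rewrite (_ : _ * _ = (g j * b j k) * - (z / (1 + G))); last by ring.
  over.
by rewrite -mulr_suml -/G; field.
Qed.

End StageGain.

(** * Dynamic programming *)

Lemma linear_lebesgue_measurable (R : realType) (c : R) :
  lebesgue_measurable_fun ( *%R c).
Proof.
move=> _ Y mY.
have mcY : measurable
    (setT `&` ( *%R c) @^-1` (Y : set (measurableTypeR R)))%classic.
  exact: mulrl_measurable.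
(* the completion consists of the unions of a Borel set and a null set *)
apply: sub_sigma_algebra; exists (setT `&` ( *%R c) @^-1` Y)%classic => //.
by exists set0; [exact: negligible_set0|rewrite setU0].
Qed.

Section DynamicProgramming.
Variables (R : realType) (n p N : nat).
Variables (a : nat -> R) (b q r : 'I_n -> nat -> R).

(** Verification step: each summand on the right is the defect of [V] in the
    Bellman equation at one time, so the sign of the defects decides how the
    cost compares with [V 0 x0]. *)
Lemma cost_telescope (i : 'I_n) (x0 : R) (u : profile R n) (V : nat -> R -> R) :
  (forall x, V N x = q i N * x ^+ (2 * p)) ->
  let x := state a b u x0 in
  cost p N a b q r i x0 u =
  V 0%N x0 + \sum_(k < N)
    (q i k * x k ^+ (2 * p) + r i k * u i k (x k) ^+ (2 * p)
     + V k.+1 (x k.+1) - V k (x k)).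
Proof.
move=> VN x; rewrite /cost -VN -/x.
under [in RHS]eq_bigr => k _ do rewrite -addrA.
rewrite [in RHS]big_split /=.
rewrite -(big_mkord xpredT (fun k => V k.+1 (x k.+1) - V k (x k))).
by rewrite telescope_sumr//=; ring.
Qed.

Hypothesis p_gt0 : (0 < p)%N.
Hypothesis q_gt0 : forall i k, (k <= N)%N -> 0 < q i k.
Hypothesis r_gt0 : forall i k, (k < N)%N -> 0 < r i k.

Let al := alpha p N a b q r.
Let us := equilibrium_profile p N a b q r.

Lemma alpha_gt0 i k : (k <= N)%N -> 0 < al i k.
Proof.
have even_ge0 (z : R) : 0 <= z ^+ (2 * p) by rewrite exprn_even_ge0// oddM.
move=> kN; rewrite -(subKn kN).
elim: (N - k)%N (leq_subr k N) => [|m IH] mN.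
  by rewrite subn0 /al alpha_N q_gt0.
have mN' : (N - m.+1 < N)%N by lia.
rewrite /al alpha_rec// -addrA ltr_pwDl ?q_gt0 ?leq_subr// addr_ge0//.
  by rewrite mulr_ge0// ltW// r_gt0.
by rewrite mulr_ge0// ltW// subnSK// IH// ltnW.
Qed.

(** The recursion for [alpha] evaluates the one-stage cost at the equilibrium
    feedback of all agents; [us] being linear, every term is a multiple of
    [x ^+ (2 * p)]. *)
Lemma alpha_Bellman_eq i k x : (k < N)%N ->
  al i k * x ^+ (2 * p) =
  q i k * x ^+ (2 * p) + r i k * us i k x ^+ (2 * p)
  + al i k.+1 * (a k * x + \sum_j b j k * us j k x) ^+ (2 * p).
Proof.
move=> kN; rewrite /al alpha_rec// !mulrDl -!mulrA -!exprMn.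
have -> : us i k x ^+ (2 * p) = (gain p N a b q r k i 0 * a k * x) ^+ (2 * p).
  by rewrite /us /equilibrium_profile mulNr !exprM sqrrN mulrA.
congr (_ + _ * _ + _ * _ ^+ _).
rewrite mulrBl mulr_suml -sumrN; congr (_ + _); apply: eq_bigr => j _.
by rewrite /us /equilibrium_profile; ring.
Qed.

Lemma state_deviation_step i v x k :
  a k * x + \sum_j b j k * deviation us i v j k x =
  a k * x + \sum_j b j k * us j k x + b i k * (v k x - us i k x).
Proof.
rewrite (bigD1 i)//= [in RHS](bigD1 i)//= /deviation eqxx.
under eq_bigr => j /negbTE ji do rewrite ji.
ring.
Qed.

(** Only the control of agent [i] changes, so the right-hand side is the
    objective of [best_response] with [y] the next state under [us]. *)
Lemma alpha_Bellman_le i v k x : (k < N)%N ->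
  al i k * x ^+ (2 * p) <=
  q i k * x ^+ (2 * p) + r i k * v k x ^+ (2 * p)
  + al i k.+1 * (a k * x + \sum_j b j k * deviation us i v j k x) ^+ (2 * p).
Proof.
move=> kN; rewrite state_deviation_step alpha_Bellman_eq//.
have al1 j : 0 < al j k.+1 by exact: alpha_gt0.
have r1 j : 0 < r j k by exact: r_gt0.
set y := a k * x + _.
have yE : y = a k * x / (1 + \sum_j stage_root p b r (al^~ k.+1) k j * b j k).
  exact: (stage_closed_loop _ _ p _ _ _ _ al1 r1).
(* the equilibrium control is proportional to the next state it produces *)
have uE : us i k x = - (stage_root p b r (al^~ k.+1) k i * y).
  rewrite /us /equilibrium_profile mulNr yE.
  by rewrite [gain _ _ _ _ _ _ _ _ _](stage_gainE _ _ p _ _ _ _ al1 r1); ring.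
rewrite uE opprK -2!addrA lerD2l best_response//.
by rewrite /stage_root odd_rootK// odd_2pB1.
Qed.

Lemma equilibrium_nash x0 : nash_equilibrium p N a b q r x0 us.
Proof.
split=> [i k _|i v _].
  rewrite (_ : us i k = *%R (- gain p N a b q r k i 0 * a k)).
    exact: linear_lebesgue_measurable.
  by apply/funext => x; rewrite /us /equilibrium_profile mulrA.
pose V k x := al i k * x ^+ (2 * p).
have VN x : V N x = q i N * x ^+ (2 * p) by rewrite /V /al alpha_N.
rewrite !(cost_telescope _ _ _ V VN) lerD2l [leLHS]big1.
  apply: sumr_ge0 => k _; rewrite subr_ge0 [deviation us i v i]/deviation eqxx.
  exact: alpha_Bellman_le.
by move=> k _; rewrite /V [in X in _ - X]alpha_Bellman_eq// subrr.
Qed.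

End DynamicProgramming.

Theorem proposition2 (R : realType) (p n N : nat)
    (a : nat -> R) (b q r : 'I_n -> nat -> R)
    (hp : (1 <= p)%N) (hn : (2 <= n)%N) (hN : (1 <= N)%N)
    (hq : forall i k, (k <= N)%N -> 0 < q i k)
    (hr : forall i k, (k < N)%N -> 0 < r i k) :
  (forall k, (k < N)%N ->
     (forall i, 1 + root_bar p N a b q r i k * b i k != 0) /\
     E_bar p N a b q r k \in unitmx) /\
  (forall x0 : R,
     nash_equilibrium p N a b q r x0 (equilibrium_profile p N a b q r)).
Proof.
split=> [k kN|x0]; last exact: equilibrium_nash.
have al1 j : 0 < alpha p N a b q r j k.+1 by apply: alpha_gt0.
have r1 j : 0 < r j k by exact: hr.
by split=> [i|]; [exact: stage_root_denom_neq0|exact: stage_E_unitmx].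
Qed.
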